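(* Let $m,n\in\mathbb N$ with $m\leq n$. Let $M$ be an $m\times m$ lower triangular matrix with rational entries whose diagonal entries are positive and whose entries below the diagonal are negative or zero. Let $F$ be a finite nonempty set of $S_0$-preserving homomorphisms from $S_n$ to $S_0$ and let $\sigma$ be an injection from $\{1,\dots,m\}$ to $\{1,\dots,n\}$. Then $P_{M,F,\sigma}$ is a compact subsemigroup of $(\beta\mathbb N)^m$ containing the idempotents of $(\beta\mathbb N)^m$.
   Context: $\mathbb A$ is a fixed nonempty finite alphabet, $S_0=\mathbb A^+$ the free semigroup of nonempty words over $\mathbb A$, and $S_n$ the set of nonempty words over $\mathbb A\cup\{v_1,\dots,v_n\}$ (distinct variables not in $\mathbb A$) in which each $v_i$ occurs. A homomorphism $\nu:S_n\to S_0$ is $S_0$-preserving if $\nu(uw)=u\nu(w)$ and $\nu(wu)=\nu(w)u$ for all $u\in S_0,w\in S_n$. $\mu_j(w)=|w|_{v_j}$. For a $k\times m$ rational matrix $M$, a finite nonempty set $F$ of homomorphisms $S_n\to S_0$ and an injection $\sigma$, $P_{M,F,\sigma}$ is the set of $\vec p=(p_1,\dots,p_k)\in(\beta\mathbb N)^k$ such that whenever $D$ is a piecewise syndetic subset of $S_0$ and $B_i\in p_i$ for all $i\le k$, there exists $w\in S_n$ with $\nu(w)\in D$ for all $\nu\in F$ and $M(\mu_{\sigma(1)}(w),\dots,\mu_{\sigma(m)}(w))^{T}\in\prod_{i=1}^kB_i$. $\beta\mathbb N$ is the Stone–Čech compactification of $(\mathbb N,+)$ with extended operation ($A\in p+q$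 iff $\{x:-x+A\in q\}\in p$); $(\beta\mathbb N)^k$ has product topology and coordinatewise operation. For a discrete semigroup $X$, $K(\beta X)$ is the smallest ideal of $\beta X$, and $D$ is piecewise syndetic if $D\in p$ for some $p\in K(\beta X)$. *)

(* Defs.v *)
From HB Require Import structures.
From mathcomp Require Import all_boot all_order all_algebra.
From mathcomp Require Import all_classical topology.

Set Implicit Arguments.
Unset Strict Implicit.
Unset Printing Implicit Defensive.

Import Order.TTheory GRing.Theory Num.Theory.
Local Open Scope classical_set_scope.
Local Open Scope ring_scope.

Section SemigroupNotions.
Variable G : semigroupType.

Definition subsemigroup (H : set G) : Prop :=
  H !=set0 /\ forall x y, H x -> H y -> H (x * y)%g.

Definition ideal (I : set G) : Prop :=
  I !=set0 /\ forall x y, I x -> I (x * y)%g /\ I (y * x)%g.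

(* This intersection is an ideal as soon as [G] has a smallest ideal, which is
   the case for [beta X] below (a compact right topological semigroup). *)
Definition smallest_ideal : set G := \bigcap_(I in ideal) I.

End SemigroupNotions.

(* The Stone-Cech compactification of the discrete space [X]: the ultrafilters
   on [X], with the sets [[set p | A \in p]] as a base of the topology. *)
Record beta (X : Type) : Type := Beta {
  beta_mem :> set X -> Prop;
  beta_ultra : UltraFilter beta_mem
}.

#[global] Existing Instance beta_ultra.

HB.instance Definition _ (X : Type) := gen_eqMixin (beta X).
HB.instance Definition _ (X : Type) := gen_choiceMixin (beta X).

Lemma beta_eq (X : Type) (p q : beta X) : (forall A, p A <-> q A) -> p = q.
Proof.
case: p q => [p Up] [q Uq] /= pq.
have E : p = q by rewrite predeqE.
by case: _ / E in Uq *; congr Beta; exact: Prop_irrelevance.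
Qed.

Section BetaTopology.
Variable X : Type.

Let clopen (A : set X) : set (beta X) := [set p | p A].

Let clopen_cover : \bigcup_(A in [set: set X]) clopen A = setT.
Proof.
by rewrite predeqE => p; split=> // _; exists setT => //; exact: filterT.
Qed.

Let clopen_join (A B : set X) (p : beta X) : [set: set X] A ->
    [set: set X] B -> clopen A p -> clopen B p ->
  exists C, [/\ [set: set X] C, clopen C p & clopen C `<=` clopen A `&` clopen B].
Proof.
move=> _ _ pA pB; exists (A `&` B); split=> //; first exact: filterI.
by move=> q H; split; apply: (filterS (F := q) _ H) => x [].
Qed.

HB.instance Definition _ :=
  isBaseTopological.Build (beta X) clopen_cover clopen_join.

End BetaTopology.

Section BetaSemigroup.
Variable X : semigroupType.
Implicit Types p q r : beta X.

Definition beta_mul_mem p q : set (set X) :=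
  [set A | p [set x | q [set y | A (x * y)%g]]].

Lemma beta_mul_ultra p q : UltraFilter (beta_mul_mem p q).
Proof.
have FF : Filter (beta_mul_mem p q).
  split.
  - suff -> : beta_mul_mem p q setT = p setT by exact: filterT.
    congr (p _); apply/seteqP; split=> // x _.
    exact: (filterT (F := q)).
  - move=> A B; rewrite /beta_mul_mem /= => pA pB.
    by apply: filterS (filterI pA pB) => x [qA qB]; exact: (filterI (F := q)).
  - move=> A B AB; rewrite /beta_mul_mem /=; apply: filterS => x /=.
    by apply: filterS => y; exact: AB.
have PF : ProperFilter (beta_mul_mem p q).
  apply: (@Build_ProperFilter_ex _ _ _ FF) => A pqA.
  have [x /(filter_ex (F := q))[y Axy]] := filter_ex (F := p) pqA.
  by exists (x * y)%g.
split=> // H HF pqH; apply/seteqP; split=> [A HA|]; last exact: pqH.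
have [//|pN] := in_ultra_setVsetC [set x | q [set y | A (x * y)%g]] (beta_ultra p).
have HN : H (~` A).
  apply: pqH; apply: (filterS (F := p)) pN => x /= qN.
  by have [|//] := in_ultra_setVsetC [set y | A (x * y)%g] (beta_ultra q).
by have [z []] := filter_ex (filterI HA HN).
Qed.

Definition beta_mul p q : beta X := Beta (beta_mul_ultra p q).

Lemma beta_mulA : associative beta_mul.
Proof.
move=> p q r; apply: beta_eq => A; rewrite /= /beta_mul_mem /=.
suff -> : [set x | q [set y | r [set z | A (x * (y * z))%g]]] =
  [set x | q [set y | r [set z | A ((x * y) * z)%g]]] by [].
by under eq_set => x do under eq_set => y do under eq_set => z do rewrite mulgA.
Qed.

HB.instance Definition _ := isSemigroup.Build (beta X) beta_mulA.

End BetaSemigroup.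

Definition beta_pow (k : nat) (X : Type) : Type := {ptws 'I_k -> beta X}.

HB.instance Definition _ (k : nat) (X : Type) :=
  Topological.copy (beta_pow k X) {ptws 'I_k -> beta X}.

Section BetaPowSemigroup.
Variables (k : nat) (X : semigroupType).

Definition beta_pow_mul (p q : beta_pow k X) : beta_pow k X :=
  fun i => (p i * q i)%g.

Lemma beta_pow_mulA : associative beta_pow_mul.
Proof. by move=> p q r; apply/funext => i; exact: mulgA. Qed.

HB.instance Definition _ := isSemigroup.Build (beta_pow k X) beta_pow_mulA.

End BetaPowSemigroup.

Definition piecewise_syndetic (X : semigroupType) (D : set X) : Prop :=
  exists2 p : beta X, smallest_ideal p & p D.

(* The semigroup (N, +), where N starts at 1; the operation of a
   [semigroupType] being written multiplicatively, [x * y] is the sum. *)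
Definition posnat : Type := {n : nat | (0 < n)%N}.

HB.instance Definition _ := SubChoice.on posnat.

Lemma posnat_add_gt0 (x y : posnat) : (0 < sval x + sval y)%N.
Proof. by rewrite addn_gt0 (svalP x). Qed.

Definition posnat_add (x y : posnat) : posnat :=
  exist (fun n : nat => (0 < n)%N) _ (posnat_add_gt0 x y).

Lemma posnat_addA : associative posnat_add.
Proof. by move=> x y z; apply: val_inj; exact: addnA. Qed.

HB.instance Definition _ := isSemigroup.Build posnat posnat_addA.

Section Words.
Variable A : choiceType.

Definition word0 : Type := {s : seq A | s != [::]}.

HB.instance Definition _ := SubChoice.on word0.

Lemma word0_cat_subproof (u v : word0) : sval u ++ sval v != [::].
Proof. by case: u => -[]. Qed.

Definition word0_cat (u v : word0) : word0 :=
  exist (fun s : seq A => s != [::]) _ (word0_cat_subproof u v).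

Lemma word0_catA : associative word0_cat.
Proof. by move=> u v w; apply: val_inj; exact: catA. Qed.

HB.instance Definition _ := isSemigroup.Build word0 word0_catA.

Variable n : nat.

(* [inl a] is the letter [a] and [inr i] the variable v_(i+1). *)
Definition is_word (s : seq (A + 'I_n)) : bool :=
  (s != [::]) && [forall i : 'I_n, inr i \in s].

Definition word : Type := {s : seq (A + 'I_n) | is_word s}.

HB.instance Definition _ := SubChoice.on word.

Lemma word_cat_subproof (v w : word) : is_word (sval v ++ sval w).
Proof.
case: v w => [v /andP[v0 /forallP vn]] [w _] /=; apply/andP; split.
  by case: v v0 {vn}.
by apply/forallP => i; rewrite mem_cat vn.
Qed.

Definition word_cat (v w : word) : word :=
  exist is_word _ (word_cat_subproof v w).

Lemma word_catA : associative word_cat.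
Proof. by move=> u v w; apply: val_inj; exact: catA. Qed.

HB.instance Definition _ := isSemigroup.Build word word_catA.

Lemma word_catl_subproof (u : word0) (w : word) :
  is_word (map inl (sval u) ++ sval w).
Proof.
case: w => [w /andP[w0 /forallP wn]] /=; apply/andP; split.
  by case: w w0 {wn} => // x w _; case: (map _ _).
by apply/forallP => i; rewrite mem_cat wn orbT.
Qed.

Lemma word_catr_subproof (w : word) (u : word0) :
  is_word (sval w ++ map inl (sval u)).
Proof.
case: w => [w /andP[w0 /forallP wn]] /=; apply/andP; split.
  by case: w w0 {wn}.
by apply/forallP => i; rewrite mem_cat wn.
Qed.

Definition word_catl (u : word0) (w : word) : word :=
  exist is_word _ (word_catl_subproof u w).

Definition word_catr (w : word) (u : word0) : word :=
  exist is_word _ (word_catr_subproof w u).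

Definition word0_preserving (nu : word -> word0) : Prop :=
  forall (u : word0) (w : word),
    nu (word_catl u w) = (u * nu w)%g /\ nu (word_catr w u) = (nu w * u)%g.

Definition mu (j : 'I_n) (w : word) : nat := count_mem (inr j) (sval w).

End Words.

Definition P_set (A : choiceType) (k m n : nat) (M : 'M[rat]_(k, m))
    (F : set {multiplicative word A n -> word0 A}) (sigma : 'I_m -> 'I_n) :
    set (beta_pow k posnat) :=
  [set p | forall (D : set (word0 A)) (B : 'I_k -> set posnat),
    piecewise_syndetic D -> (forall i, p i (B i)) ->
    exists w : word A n,
      (forall nu, F nu -> D (nu w)) /\
      forall i, exists2 b : posnat, B i b &
        (M *m \col_j (mu (sigma j) w)%:R) i 0 = (sval b)%:R].

(* Main.v *)
(** For closure under the operation, write a point of [K(beta S_0)] whose members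
    include [D] as [s * e] with [s] and [e] in [K(beta S_0)]: then
    [{a | a^-1 D \in e}] is piecewise syndetic, and a word [v] chosen for it and
    for [p] can be completed by a word [w] chosen for the piecewise syndetic set of
    the [b] with [nu(v) b] in [D] for all [nu], and for [q].

    Now let [p] be idempotent. Each [p_i] contains [d N] for every [d], so the
    triangular system [M x \in B_1 x ... x B_m] is solvable, and by compactness the
    fiber [Z] of points of [beta S_n] that [M mu] maps to [p] is a nonempty closed
    subsemigroup; it is stable under right multiplication by [beta S_0] because
    [mu] does not see the letters of the alphabet. Let [L] be a minimal left ideal
    of [beta S_0]. Those [z \in Z] with [nu(z) \in L] for all [nu \in F] form a
    closed subsemigroup, which has an idempotent [f]. Each [nu(f)] is an idempotent
    of [L], hence a right identity of [L], so that [x * f] lies over [x] for all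
    [nu \in F] at once, for every [x \in L]. As [K(beta S_0)] is contained in the
    ideal [L * beta S_0], this reaches every piecewise syndetic set. *)

Require Import Defs.
From mathcomp Require Import all_boot all_order all_algebra.
From mathcomp Require Import all_classical topology.

Set Implicit Arguments.
Unset Strict Implicit.
Unset Printing Implicit Defensive.

Import Order.TTheory GRing.Theory Num.Theory.
Local Open Scope classical_set_scope.
Local Open Scope ring_scope.

(** * Ultrafilters and the compact Hausdorff topology of [beta X] *)

Lemma ultra_of_dichotomy (T : Type) (F : set_system T) :
  ProperFilter F -> (forall A, F A \/ F (~` A)) -> UltraFilter F.
Proof.
move=> PF FC; split=> // H HF FH; apply/seteqP; split=> [A HA|]; last exact: FH.
have [//|/FH HN] := FC A.
by have [x []] := filter_ex (filterI HA HN).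
Qed.

Lemma filter_finite_forall (T I : Type) (F : set_system T) (D : set I)
    (A : I -> set T) : Filter F -> finite_set D -> (forall i, D i -> F (A i)) ->
  F [set x | forall i, D i -> A i x].
Proof.
move=> FF /(@finite_seqP {classic I})[s ->]; elim: s => [_|i s IHs FA].
  by apply: filterS filterT => x _ i.
have FAs : F [set x | forall j, j \in s -> A j x].
  by apply: IHs => j js; apply: FA; rewrite /= in_cons js orbT.
have FAi : F (A i) by apply: FA; rewrite /= mem_head.
apply: filterS (filterI FAi FAs) => x [Aix Asx] j /=.
by rewrite in_cons => /orP[/eqP ->|/Asx].
Qed.

Section BetaSpace.
Variable X : Type.
Implicit Types (p q : beta X) (A : set X).

Lemma beta_setC p A : p (~` A) <-> ~ p A.
Proof.
split=> [pN pA|npA]; first by have [x []] := filter_ex (filterI pA pN).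
by have [|//] := in_ultra_setVsetC A (beta_ultra p).
Qed.

Lemma beta_openP (U : set (beta X)) :
  open U <-> forall p, U p -> exists2 A, p A & [set q : beta X | q A] `<=` U.
Proof.
split=> [[D' _ <-] p [A D'A pA]|UP].
  by exists A => // q qA; exists A.
exists [set A | [set q : beta X | q A] `<=` U] => //.
apply/seteqP; split=> [p [A AU pA]|p /UP[A pA AU]]; first exact: AU.
by exists A.
Qed.

Lemma beta_open_mem A : open [set p : beta X | p A].
Proof. by apply/beta_openP => p pA; exists A. Qed.

Lemma beta_closed_mem A : closed [set p : beta X | p A].
Proof.
rewrite -[X in closed X]setCK; apply: open_closedC.
suff -> : ~` [set p : beta X | p A] = [set p : beta X | p (~` A)].
  exact: beta_open_mem.
by apply/seteqP; split=> p /beta_setC.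
Qed.

Lemma beta_hausdorff : hausdorff_space (beta X).
Proof.
move=> p q pq; apply: beta_eq.
suff H A : p A -> q A.
  move=> A; split; first exact: H.
  by move=> qA; apply: contrapT => /beta_setC/H/beta_setC.
move=> pA; apply: contrapT => /beta_setC qA.
have [r [/= rA rN]] := pq _ _
  (open_nbhs_nbhs (conj (beta_open_mem A) pA))
  (open_nbhs_nbhs (conj (beta_open_mem (~` A)) qA)).
exact: (proj1 (beta_setC _ _) rN).
Qed.

Lemma beta_compact : compact [set: beta X].
Proof.
rewrite compact_ultra => F FU _.
(* The limit of [F]: the sets [A] whose basic clopen set belongs to [F]. *)
pose q := [set A | F [set p : beta X | p A]].
have qF : Filter q.
  split.
  - by apply: (filterS _ (filterT (F := F))) => p _; exact: (filterT (F := p)).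
  - move=> A B qA qB; apply: (filterS _ (filterI (F := F) qA qB)) => p [].
    exact: (filterI (F := p)).
  - by move=> A B AB; apply: (filterS (F := F)) => p; exact: (filterS (F := p)).
have qP : ProperFilter q.
  by apply: Build_ProperFilter_ex => A /(filter_ex (F := F))[p]; exact: filter_ex.
have qU : UltraFilter q.
  apply: ultra_of_dichotomy => A.
  have [|FN] := in_ultra_setVsetC [set p : beta X | p A] FU; first by left.
  by right; apply: filterS FN => p /= npA; apply/beta_setC.
exists (Beta qU); split=> // U; rewrite nbhsE => -[V [oV Vq] VU].
have [A qA AV] := (proj1 (beta_openP V) oV) _ Vq.
by apply: (filterS (F := F) _ qA) => p /AV/VU.
Qed.

End BetaSpace.

Lemma beta_continuous (X Y : Type) (f : beta X -> beta Y) (g : set Y -> set X) :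
  (forall p A, f p A <-> p (g A)) -> continuous f.
Proof.
move=> fg; apply/continuousP => U /beta_openP oU; apply/beta_openP => p /oU[A pA AU].
by exists (g A); [exact/fg|move=> q /fg /AU].
Qed.

Lemma closed_beta_compact (X : Type) (C : set (beta X)) : closed C -> compact C.
Proof. by move=> Cc; exact: (subclosed_compact Cc (@beta_compact X)). Qed.

(** * Images and limits of ultrafilters *)

Section BetaBind.
Variables X Y : Type.

Definition beta_map_mem (f : X -> Y) (p : beta X) : set (set Y) :=
  [set A | p (f @^-1` A)].

Lemma beta_map_ultra f p : UltraFilter (beta_map_mem f p).
Proof.
have FF : Filter (beta_map_mem f p).
  split; first exact: (filterT (F := p)).
  - by move=> A B; exact: (filterI (F := p)).
  - by move=> A B AB; apply: (filterS (F := p)) => x; exact: AB.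
have PF : ProperFilter (beta_map_mem f p).
  by apply: Build_ProperFilter_ex => A /(filter_ex (F := p))[x]; exists (f x).
by apply: ultra_of_dichotomy => A; exact: (in_ultra_setVsetC _ (beta_ultra p)).
Qed.

Definition beta_map f p : beta Y := Beta (beta_map_ultra f p).

Lemma beta_map_continuous f : continuous (beta_map f).
Proof. exact: (@beta_continuous _ _ _ (fun A => f @^-1` A)). Qed.

(** The limit of [k x] as [x] tends to [p]. It serves to multiply an ultrafilter on words with
    variables by one on words over the alphabet, which live in different semigroups. *)
Definition beta_bind_mem (p : beta X) (k : X -> beta Y) : set (set Y) :=
  [set A | p [set x | k x A]].

Lemma beta_bind_ultra p k : UltraFilter (beta_bind_mem p k).
Proof.
have FF : Filter (beta_bind_mem p k).
  split.
  - by apply: filterS (filterT (F := p)) => x _; exact: (filterT (F := k x)).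
  - move=> A B pA pB; apply: (filterS _ (filterI (F := p) pA pB)) => x [].
    exact: (filterI (F := k x)).
  - by move=> A B AB; apply: (filterS (F := p)) => x; exact: filterS.
have PF : ProperFilter (beta_bind_mem p k).
  apply: Build_ProperFilter_ex => A /(filter_ex (F := p))[x].
  exact: (filter_ex (F := k x)).
apply: ultra_of_dichotomy => A.
have [|pN] := in_ultra_setVsetC [set x | k x A] (beta_ultra p); first by left.
by right; apply: (filterS (F := p)) pN => x /= ?; apply/beta_setC.
Qed.

Definition beta_bind p k : beta Y := Beta (beta_bind_ultra p k).

End BetaBind.

(** * Minimal closed sets, idempotents and ideals *)

(** Zorn's lemma on complements; compactness keeps the intersection of a chain nonempty. The
    predicate [Q] stands for being closed under products or under left multiplication. *)
Lemma minimal_closed (T : topologicalType) (Q : set T -> Prop) (C : set T) :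
  compact [set: T] ->
  (forall G : set (set T), G `<=` Q -> Q (\bigcap_(B in G) B)) ->
  closed C -> C !=set0 -> Q C ->
  exists C0, [/\ C0 `<=` C, closed C0, C0 !=set0, Q C0 &
    forall B, B `<=` C0 -> closed B -> B !=set0 -> Q B -> B = C0].
Proof.
move=> Tc QG Cc C_neq0 QC.
pose P := [set U : set T | [/\ closed (~` U), (~` U `&` C) !=set0 & Q (~` U)]].
have CP : compact C by exact: subclosed_compact Tc _.
have [|A [[Ac A0 QA] Amax]] := @Zorn_bigcup T P.
  move=> F FP Ftot.
  have -> : P (\bigcup_(U in F) U) = P (~` \bigcap_(U in F) ~` U).
    by rewrite setC_bigcap; congr (P _); apply: eq_bigcupr => U _; rewrite setCK.
  rewrite /P /= !setCK; split.
  - by apply: closed_bigI => U /FP[].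
  (* Adding the empty set, whose complement meets [C] in [C], covers the empty chain. *)
  - pose D := F `|` [set set0].
    have DP U : D U -> (~` U `&` C) !=set0.
      by move=> [/FP[]//|->]; rewrite setC0 setTI.
    have DF : ProperFilter (filter_from D (fun U => ~` U `&` C)).
      apply: filter_from_proper => //; apply: filter_from_filter.
        by exists set0; right.
      move=> U V DU DV; have [UV|VU] : U `<=` V \/ V `<=` U.
      + by case: DU DV => [FU|->] [FV|->]; try (by left); [exact: Ftot|right].
      + by exists V => // x [Vx Cx]; do !split => //; apply: contra_not Vx => /UV.
      + by exists U => // x [Ux Cx]; do !split => //; apply: contra_not Ux => /VU.
    have [|x [Cx xcl]] := CP _ DF; first by exists set0; [right|move=> x []].
    exists x; split=> // U FU; have [Uc _ _] := FP _ FU.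
    apply: Uc => V Vx; apply: xcl Vx; exists U; first by left.
    by move=> y [].
  - rewrite -(bigcap_image F setC id); apply: QG => _ [U /FP[_ _ QU] <-].
    exact: QU.
exists (~` A `&` C); split => //.
- exact: closedI.
- have -> : ~` A `&` C = \bigcap_(B in [set ~` A; C]) B.
    by rewrite bigcap_setU !bigcap_set1.
  by apply: QG => _ [->|->].
- move=> B BC0 Bc [x Bx] QB; apply: contrapT => BNC0.
  apply: (Amax (~` B)).
    split=> [|BA]; first by move=> y Ay /BC0[].
    apply: BNC0; apply/seteqP; split=> // y [Ay _].
    by apply: contrapT => /BA.
  by rewrite /P /= setCK; split=> //; exists x; split => //; have [] := BC0 _ Bx.
Qed.

Section Ellis.
Variable X : semigroupType.
Implicit Types p q r : beta X.

Lemma beta_mulr_continuous q : continuous (fun p => (p * q)%g).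
Proof.
exact: (@beta_continuous _ _ _ (fun A => [set x | q [set y | A (x * y)%g]])).
Qed.

Lemma closed_mulr q (C : set (beta X)) :
  closed C -> closed [set (p * q)%g | p in C].
Proof.
move=> /closed_beta_compact Cc; apply: compact_closed (@beta_hausdorff X) _.
apply: continuous_compact Cc; apply: continuous_subspaceT.
exact: beta_mulr_continuous.
Qed.

(** In a minimal closed subsemigroup [B] containing [e], minimality gives [B * e = B]. So the [p] in
    [B] with [p * e = e] form a nonempty closed subsemigroup, which is again all of [B] and thus
    contains [e]. *)
Lemma ellis (C : set (beta X)) : closed C -> subsemigroup C ->
  exists2 e, C e & (e * e)%g = e.
Proof.
move=> Cc [C0 CM].
have [|//|//|//|B [BC Bc [e Be] BM Bmin]] := @minimal_closed (beta X)
  (fun B => forall x y, B x -> B y -> B (x * y)%g) C (@beta_compact X).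
  by move=> G GQ x y Gx Gy B GB; apply: (GQ _ GB); [exact: Gx|exact: Gy].
have Bep : [set (p * e)%g | p in B] = B.
  apply: Bmin.
  - by move=> _ [p Bp <-]; exact: BM.
  - exact: closed_mulr.
  - by exists (e * e)%g, e.
  - move=> _ _ [p Bp <-] [q Bq <-]; exists (p * e * q)%g; rewrite ?mulgA //.
    exact: BM (BM _ _ Bp Be) Bq.
have Fe : B `&` [set p | (p * e)%g = e] = B.
  apply: Bmin.
  - by move=> p [].
  - have e1 : closed [set e].
      exact/accessible_closed_set1/hausdorff_accessible/beta_hausdorff.
    apply: closedI => //.
    exact: (proj1 (continuous_closedP _) (@beta_mulr_continuous e) _ e1).
  - by move: Be; rewrite -{1}Bep => -[p Bp pe]; exists p.
  - move=> p q [Bp pe] [Bq qe]; split; first exact: BM.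
    by rewrite /= -mulgA qe.
by exists e; [exact: BC|move: Be; rewrite -Fe => -[]].
Qed.

(** For [q] in a minimal closed left ideal [L], the set of all [r * q] is a closed left ideal inside
    [L], hence equal to [L]. The point [p0] shows that the space is nonempty. *)
Lemma minimal_left_ideal (p0 : beta X) : exists L : set (beta X),
  [/\ closed L, L !=set0, forall p q, L q -> L (p * q)%g &
    forall p q, L p -> L q -> exists r, p = (r * q)%g].
Proof.
have [||||L [_ Lc L0 LM Lmin]] := @minimal_closed (beta X)
  (fun B => forall p q, B q -> B (p * q)%g) setT (@beta_compact X).
- by move=> G GQ p q Gq B GB; apply: (GQ _ GB); exact: Gq.
- exact: closedT.
- by exists p0.
- by [].
exists L; split=> // p q Lp Lq.
have Lqp : [set (r * q)%g | r in [set: beta X]] = L.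
  apply: Lmin.
  - by move=> _ [r _ <-]; exact: LM.
  - exact/closed_mulr/closedT.
  - by exists (p * q)%g, p.
  - by move=> r _ [s _ <-]; exists (r * s)%g; rewrite ?mulgA.
by move: Lp; rewrite -Lqp => -[r _ <-]; exists r.
Qed.

End Ellis.

(** The products of two elements of the smallest ideal themselves form an ideal. *)
Lemma smallest_ideal_mul (G : semigroupType) (r : G) : smallest_ideal r ->
  exists s e : G, [/\ smallest_ideal s, smallest_ideal e & r = (s * e)%g].
Proof.
move=> Kr.
have KM (x y : G) : smallest_ideal x ->
    smallest_ideal (x * y)%g /\ smallest_ideal (y * x)%g.
  move=> Kx; split=> I II; have [_ IM] := II; have Ix := Kx I II.
    by have [] := IM x y Ix.
  by have [] := IM x y Ix.
pose I := [set x : G | exists s e : G,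
  [/\ smallest_ideal s, smallest_ideal e & x = (s * e)%g]].
apply: (Kr I); split; first by exists (r * r)%g, r, r.
move=> x y [s [e [Ks Ke ->]]]; split.
  by exists s, (e * y)%g; rewrite mulgA; split=> //; have [] := KM e y Ke.
by exists (y * s)%g, e; rewrite mulgA; split=> //; have [] := KM s y Ks.
Qed.

(** * Row values of words; compactness of [P_set] and closure under products *)

Lemma count_inr_inl (T U : eqType) (y : U) (s : seq T) :
  count_mem (inr y) [seq inl x | x <- s] = 0%N.
Proof. by rewrite count_map; elim: s. Qed.

Section RowValues.
Variables (A : choiceType) (k m n : nat) (M : 'M[rat]_(k, m)) (sigma : 'I_m -> 'I_n).

Definition row_value (i : 'I_k) (w : word A n) : rat :=
  (M *m \col_j (mu (sigma j) w)%:R) i 0.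

Definition row_in (i : 'I_k) (B : set posnat) (w : word A n) : Prop :=
  exists2 b, B b & row_value i w = (sval b)%:R.

Lemma row_valueE i w : row_value i w = \sum_j M i j * (mu (sigma j) w)%:R.
Proof. by rewrite /row_value mxE; apply: eq_bigr => j _; rewrite mxE. Qed.

Lemma row_valueM i v w : row_value i (v * w)%g = row_value i v + row_value i w.
Proof.
rewrite !row_valueE -big_split; apply: eq_bigr => j _ /=.
by rewrite -mulrDr -natrD /mu /= count_cat.
Qed.

Lemma row_value_catl i u w : row_value i (word_catl u w) = row_value i w.
Proof.
rewrite !row_valueE; apply: eq_bigr => j _; congr (_ * _%:R).
by rewrite /mu /= count_cat count_inr_inl add0n.
Qed.

Lemma row_value_catr i w u : row_value i (word_catr w u) = row_value i w.
Proof.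
rewrite !row_valueE; apply: eq_bigr => j _; congr (_ * _%:R).
by rewrite /mu /= count_cat count_inr_inl addn0.
Qed.

Variable F : set {multiplicative word A n -> word0 A}.

(** For fixed [D] and [B], the points with [B i] in their [i]-th coordinate for all of the finitely
    many [i] form a neighborhood of [p], which meets [P_set]. *)
Lemma P_set_closed : closed (P_set M F sigma).
Proof.
move=> p pcl D B psD pB.
have [|q [qP qB]] := pcl [set q : beta_pow k posnat | forall i, q i (B i)].
  apply: (@filter_forall _ _ (fun i => [set q : beta_pow k posnat | q i (B i)])
    (nbhs p) (nbhs_filter p)) => i.
  apply: (@proj_continuous _ (fun=> beta posnat) i p [set r : beta posnat | r (B i)]).
  apply: open_nbhs_nbhs; split; [exact: beta_open_mem|exact: pB].
exact: qP.
Qed.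

Lemma P_set_compact : compact (P_set M F sigma).
Proof.
have T := @tychonoff _ (fun _ : 'I_k => beta posnat) (fun=> setT)
  (fun=> @beta_compact posnat).
exact: (subclosed_compact P_set_closed T).
Qed.

Lemma P_set_mul (p q : beta_pow k posnat) : finite_set F ->
  P_set M F sigma p -> P_set M F sigma q -> P_set M F sigma (p * q)%g.
Proof.
move=> Ffin Pp Pq D B [_ /smallest_ideal_mul[s [e [Ks Ke ->]]] seD] pqB.
have [||v [vD vB]] := Pp [set a | e [set b | D (a * b)%g]]
  (fun i => [set x | q i [set y | B i (x * y)%g]]).
- by exists s.
- exact: pqB.
have /choice[x xP] : forall i, exists b : posnat,
    q i [set y | B i (b * y)%g] /\ row_value i v = (sval b)%:R.
  by move=> i; have [b] := vB i; exists b.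
(* As [F] is finite, the first set belongs to [e], hence is piecewise syndetic; [x i] is the value
   of row [i] at [v]. *)
have [||w [wD wB]] := Pq [set b | forall nu : {multiplicative word A n -> word0 A},
    F nu -> D (nu v * b)%g] (fun i => [set y | B i (x i * y)%g]).
- by exists e => //; apply: filter_finite_forall => // nu /vD.
- by move=> i; have [] := xP i.
exists (v * w)%g; split=> [nu Fnu|i]; first by rewrite gmulfM; exact: wD.
have [y By wy] := wB i; exists (x i * y)%g => //.
by rewrite -/(row_value i _) row_valueM (xP i).2 [row_value i w]wy -natrD.
Qed.

End RowValues.

(** * Divisibility in idempotents and triangular systems *)

(** Some residue class [c] modulo [d] belongs to [p]. Idempotence gives [x], [y] and their sum all
    in this class, so [c + c] is congruent to [c], and [c] to 0. *)
Lemma idempotent_dvdn (p : beta posnat) (d : nat) : (p * p)%g = p -> (0 < d)%N ->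
  p [set x | (d %| sval x)%N].
Proof.
move=> pp d0; pose C c := [set x : posnat | sval x = c %[mod d]].
have [c pC] : exists c : 'I_d, p (C c).
  apply: contrapT => /forallNP pNC.
  have : p [set x | forall c : 'I_d, ~ C c x].
    by apply: filter_forall => c; apply/beta_setC.
  move=> /(filter_ex (F := p))[x xNC]; apply: (xNC (Ordinal (ltn_pmod (sval x) d0))).
  by rewrite /C /= modn_mod.
have : p [set x | p [set y | C c (x * y)%g]] by move: pC; rewrite -{1}pp.
move=> /(filterI (F := p) pC) /(filter_ex (F := p))[x [xC]].
move=> /(filterI (F := p) pC) /(filter_ex (F := p))[y [yC xyC]].
have c0 : (d %| c)%N.
  have : c + c = c + 0 %[mod d].
    rewrite addn0 -xyC.
    have -> : sval (x * y)%g = (sval x + sval y)%N by [].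
    by rewrite -[RHS]modnDm xC yC modnDm.
  by move/eqP; rewrite eqn_modDl mod0n.
apply: filterS pC => z zC.
by rewrite /= /dvdn zC.
Qed.

Lemma common_denominator (I : finType) (f : I -> rat) :
  exists2 a : nat, (0 < a)%N & forall i, a%:R * f i \is a Num.int.
Proof.
exists (\prod_i `|denq (f i)|)%N.
  by apply: prodn_gt0 => i; rewrite absz_gt0 denq_neq0.
move=> i; rewrite (bigD1 i) //= mulnC natrM -mulrA rpredM ?natr_int //.
have -> : `|denq (f i)|%:R = (denq (f i))%:~R :> rat.
  by rewrite -[X in _ = X%:~R]gez0_abs ?denq_ge0.
by rewrite mulrC -numqE intr_int.
Qed.

(* Rows are solved from top to bottom; the entries chosen earlier are kept divisible
   by enough to make the division by the diagonal entry exact, and the sign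
   condition below the diagonal makes the new entry positive. *)
Lemma triangular_solution (m : nat) (M : 'M[rat]_m) (B : 'I_m -> set posnat) :
    is_trig_mx M -> (forall i, 0 < M i i) ->
    (forall i j : 'I_m, (j < i)%N -> M i j <= 0) ->
    (forall i d, (0 < d)%N -> exists2 b, B i b & (d %| sval b)%N) ->
  exists x : 'I_m -> nat, (forall j, 0 < x j)%N /\
    forall i, exists2 b, B i b & \sum_j M i j * (x j)%:R = (sval b)%:R.
Proof.
move=> /is_trig_mxP M0 Mdiag Mneg Bdvd.
suff H k : (k <= m)%N -> forall N : nat, (0 < N)%N -> exists x : 'I_m -> nat,
    [/\ forall j, (0 < x j)%N, forall j, (N %| x j)%N & forall i : 'I_m, (i < k)%N ->
    exists2 b, B i b & \sum_j M i j * (x j)%:R = (sval b)%:R].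
  by have [x [x0 _ xP]] := H m (leqnn m) 1%N isT; exists x; split=> // i; exact: xP.
elim: k => [_ N N0|k IHk km N N0]; first by exists (fun=> N).
pose i0 := Ordinal km.
(* The coefficients that appear when row [i0] is solved for its diagonal unknown; [a] clears their
   denominators. *)
pose c (o : option 'I_m) := if o is Some j then M i0 j / M i0 i0 else (M i0 i0)^-1.
have [a a0 aP] := common_denominator c.
have Na0 : (0 < N * a)%N by rewrite muln_gt0 N0.
have [x [x0 xN xP]] := IHk (ltnW km) _ Na0.
have [b Bb bN] := Bdvd i0 _ Na0.
have cN o y : (N * a %| y)%N -> c o * y%:R / N%:R \is a Num.int.
  move=> /dvdnP[z ->]; rewrite !natrM.
  have -> : c o * (z%:R * (N%:R * a%:R)) / N%:R = z%:R * (a%:R * c o).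
    rewrite [N%:R * _]mulrC !mulrA mulfK ?pnatr_eq0 -?lt0n //.
    by rewrite [c o * _]mulrC -!mulrA [c o * _]mulrC.
  by rewrite rpredM ?natr_int.
pose t := c None * (sval b)%:R - \sum_(j | j != i0) c (Some j) * (x j)%:R.
have Mi0 : M i0 i0 != 0 by rewrite lt0r_neq0.
have tE : M i0 i0 * t + \sum_(j | j != i0) M i0 j * (x j)%:R = (sval b)%:R.
  rewrite /t mulrBr mulrA divff // mul1r mulr_sumr.
  rewrite (eq_bigr (fun j => M i0 j * (x j)%:R)) ?subrK // => j _ /=.
  by rewrite mulrA [_ / _]mulrC mulrA divff // mul1r.
have t0 : 0 < t.
  rewrite -(pmulr_rgt0 _ (Mdiag i0)) -subr_gt0 subr0.
  rewrite -[X in _ < X](addrK (\sum_(j | j != i0) M i0 j * (x j)%:R)) tE subr_gt0.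
  apply: (@le_lt_trans _ _ 0); last by rewrite ltr0n (svalP b).
  apply: sumr_le0 => j ji0; rewrite mulr_le0_ge0 ?ler0n //.
  have [ij|ji|/val_inj ij] := ltngtP i0 j; first by rewrite M0.
    exact: Mneg.
  by rewrite ij eqxx in ji0.
have /natrP[y yE] : t / N%:R \is a Num.nat.
  rewrite natrEint divr_ge0 ?ler0n ?(ltW t0) // andbT.
  rewrite /t mulrBl rpredB ?cN // mulr_suml rpred_sum // => j _.
  exact: cN.
have N_neq0 : N%:R != 0 :> rat by rewrite pnatr_eq0 -lt0n.
have tyN : t = (y * N)%:R by rewrite natrM -yE divfK.
have yN0 : (0 < y * N)%N by rewrite -(ltr0n rat) -tyN.
exists (fun j => if j == i0 then y * N else x j)%N; split.
- by move=> j; case: ifP.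
- move=> j; case: ifP => _; first exact: dvdn_mull.
  by apply: dvdn_trans (xN j); exact: dvdn_mulr.
- move=> i; rewrite ltnS leq_eqVlt => /orP[/eqP ik|ik].
    have -> : i = i0 by exact: val_inj.
    exists b => //; rewrite (bigD1 i0) //= eqxx -tyN -[RHS]tE; congr (_ + _).
    by apply: eq_bigr => j /negbTE ->.
  (* Rows above [i0] vanish in column [i0], so the new entry leaves them solved. *)
  have [b' Bb' bE] := xP i ik; exists b' => //; rewrite -bE.
  apply: eq_bigr => j _; case: eqP => // ->.
  by rewrite M0 // !mul0r.
Qed.

Lemma word_with_counts (A : choiceType) (n : nat) (c : 'I_n -> nat) :
  (0 < n)%N -> (forall i, 0 < c i)%N ->
  exists w : word A n, forall i, mu i w = c i.
Proof.
move=> n0 c0.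
pose s : seq (A + 'I_n) := flatten [seq nseq (c i) (inr i) | i <- enum 'I_n].
have sc i : count_mem (inr i) s = c i.
  rewrite count_flatten -map_comp sumnE big_map big_enum /= (bigD1 i) //=.
  rewrite count_nseq /= eqxx mul1n big1 ?addn0 // => j ji.
  by rewrite count_nseq /= (inj_eq inr_inj) (negbTE ji).
have si i : inr i \in s by rewrite -has_pred1 has_count sc.
have sw : is_word s.
  apply/andP; split; last exact/forallP.
  by apply: contraTneq (si (Ordinal n0)) => ->.
by exists (exist _ s sw).
Qed.

(** * The fiber over an idempotent, and membership of idempotents in [P_set] *)

Section IdempotentsInP.
Variables (A : choiceType) (m n : nat) (M : 'M[rat]_m) (sigma : 'I_m -> 'I_n).
Hypotheses (m_gt0 : (0 < m)%N) (le_mn : (m <= n)%N) (M_lower : is_trig_mx M).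
Hypotheses (M_diag : forall i : 'I_m, 0 < M i i)
  (M_below : forall i j : 'I_m, (j < i)%N -> M i j <= 0).
Hypothesis sigma_inj : injective sigma.
Variable p : beta_pow m posnat.
Hypothesis pp : (p * p)%g = p.

Let ppi i : (p i * p i)%g = p i.
Proof. exact: (congr1 (fun q : beta_pow m posnat => q i) pp). Qed.

Lemma exists_word_row_in (B : 'I_m -> set posnat) : (forall i, p i (B i)) ->
  exists w : word A n, forall i, row_in M sigma i (B i) w.
Proof.
move=> pB.
have [|x [x0 xB]] := triangular_solution (B := B) M_lower M_diag M_below.
  move=> i d d0; have /(filterI (F := p i) (pB i)) := idempotent_dvdn (ppi i) d0.
  by move=> /(filter_ex (F := p i))[b [Bb db]]; exists b.
(* Variables outside the range of [sigma] must still occur in the word; each gets count 1. *)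
pose c i := if [pick j | sigma j == i] is Some j then x j else 1%N.
have [||w wc] := @word_with_counts A n c; first exact: leq_trans le_mn.
  by move=> i; rewrite /c; case: pickP.
exists w => i; have [b Bb bE] := xB i; exists b => //.
rewrite row_valueE -bE; apply: eq_bigr => j _; congr (_ * _%:R); rewrite wc /c.
by case: pickP => [j' /eqP/sigma_inj ->|/(_ j)]; rewrite ?eqxx.
Qed.

(** The points that [M mu] sends to [p], described by membership because [M mu(w)] is a rational
    vector that need not have positive integer entries. *)
Definition fiber : set (beta (word A n)) :=
  [set z | forall i B, p i B -> z (row_in M sigma i B)].

Lemma fiber_closed : closed fiber.
Proof.
move=> z zcl i B piB.
apply: (@beta_closed_mem _ (row_in M sigma i B)) => V /zcl[y [yf Vy]].
by exists y; split=> //; exact: yf.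
Qed.

(** Solvability of the triangular system makes the sets of words with values in a product of members
    of the [p i] a base of a proper filter; any ultrafilter refining it will do. *)
Lemma fiber_neq0 : fiber !=set0.
Proof.
pose base := filter_from [set B : 'I_m -> set posnat | forall i, p i (B i)]
  (fun B => [set w : word A n | forall i, row_in M sigma i (B i) w]).
have PF : ProperFilter base.
  apply: filter_from_proper => [|B]; last exact: exists_word_row_in.
  apply: filter_from_filter.
    by exists (fun=> setT) => i; exact: (filterT (F := p i)).
  move=> B C pB pC; exists (fun i => B i `&` C i).
    by move=> i; exact: (filterI (F := p i)).
  by move=> w wBC; split=> i; have [b [Bb Cb] bE] := wBC i; exists b.
have [G [GU baseG]] := ultraFilterLemma PF.
exists (Beta GU) => i B piB; apply: baseG.
exists (fun j => if j == i then B else setT).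
  by move=> j; case: eqP => [->//|_]; exact: (filterT (F := p j)).
by move=> w /(_ i); rewrite eqxx.
Qed.

(** Row values add up over products of words, and each [p i] is idempotent. *)
Lemma fiber_mul (y z : beta (word A n)) : fiber y -> fiber z -> fiber (y * z)%g.
Proof.
move=> yf zf i B; rewrite -{1}ppi => /yf.
apply: (filterS (F := y)) => v [b /zf zB vb].
apply: (filterS (F := z)) zB => w [b' Bb' wb]; exists (b * b')%g => //.
by rewrite row_valueM vb wb -natrD.
Qed.

Lemma fiber_catr (z : beta (word A n)) (e : beta (word0 A)) : fiber z ->
  fiber (beta_bind z (fun w => beta_map (word_catr w) e)).
Proof.
move=> zf i B /zf; apply: (filterS (F := z)) => w [b Bb wb].
apply: (filterS _ (filterT (F := e))) => u _; exists b => //.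
by rewrite row_value_catr.
Qed.

Variable F : set {multiplicative word A n -> word0 A}.
Hypotheses (F_fin : finite_set F) (F_pres : forall nu, F nu -> word0_preserving nu).

Lemma beta_map_mul (nu : {multiplicative word A n -> word0 A})
    (y z : beta (word A n)) :
  beta_map nu (y * z)%g = (beta_map nu y * beta_map nu z)%g.
Proof.
apply: beta_eq => D.
suff -> : beta_map nu (y * z)%g D = (beta_map nu y * beta_map nu z)%g D by [].
congr (y _); apply/seteqP; split=> v; apply: (filterS (F := z)) => w /=;
  by rewrite gmulfM.
Qed.

(* An idempotent of a minimal left ideal [L] is a right identity of [L]; applied to the
   images under [F] of one idempotent of the fiber over [p], this moves the fiber
   to points over every [x] in [L]. *)
Lemma fiber_over_left_ideal (L : set (beta (word0 A))) :
    closed L -> L !=set0 -> (forall r q, L q -> L (r * q)%g) ->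
    (forall r q, L r -> L q -> exists s, r = (s * q)%g) ->
  exists2 f, fiber f & forall nu x, F nu -> L x -> (x * beta_map nu f)%g = x.
Proof.
move=> Lc [e Le] Ll Lmin.
pose Z := fiber `&` \bigcap_(nu in F) (beta_map nu @^-1` L).
have Zc : closed Z.
  apply: closedI; first exact: fiber_closed.
  apply: closed_bigI => nu _.
  exact: (proj1 (continuous_closedP _) (@beta_map_continuous _ _ nu)).
have ZM : subsemigroup Z.
  split; last first.
    move=> y z [yf yL] [zf zL]; split; first exact: fiber_mul.
    by move=> nu Fnu; rewrite /preimage /= beta_map_mul; exact/Ll/zL.
  (* Right multiplication by [e] keeps [z] in the fiber and moves all its images under [F] into the
     left ideal [L]. *)
  have [z zf] := fiber_neq0.
  exists (beta_bind z (fun w => beta_map (word_catr w) e)); split.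
    exact: fiber_catr.
  move=> nu Fnu; rewrite /preimage /=.
  suff -> : beta_map nu (beta_bind z (fun w => beta_map (word_catr w) e)) =
    (beta_map nu z * e)%g by exact: Ll.
  apply: beta_eq => D; rewrite /= /beta_map_mem /= /beta_bind_mem /=.
  suff -> : [set w | beta_map_mem (word_catr w) e (nu @^-1` D)] =
    nu @^-1` [set a | e [set b | D (a * b)%g]] by [].
  apply/seteqP; split=> w; apply: (filterS (F := e)) => u /=;
    by rewrite (F_pres Fnu u w).2.
have [f [ff fL] fid] := ellis Zc ZM.
exists f => // nu x Fnu Lx.
have [s ->] := Lmin x (beta_map nu f) Lx (fL nu Fnu).
by rewrite -mulgA -beta_map_mul fid.
Qed.

(** With [r = x * s] and [x] in [L], the word is [u w b], where [u], [w], [b] are chosen in members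
    of [x], [f], [s]. The flanks [u] and [b] pass through every [nu] in [F] and do not change row
    values. *)
Lemma P_set_idempotent : P_set M F sigma p.
Proof.
move=> D B [r Kr rD] pB.
have [L [Lc L0 Ll Lmin]] := minimal_left_ideal r.
have [f ff fid] := fiber_over_left_ideal Lc L0 Ll Lmin.
have [x [s [Lx rxs]]] : exists x s, L x /\ r = (x * s)%g.
  apply: (Kr [set q | exists x s, L x /\ q = (x * s)%g]); split.
    by have [x Lx] := L0; exists (x * x)%g, x, x.
  move=> _ t [x [s [Lx ->]]]; split.
    by exists x, (s * t)%g; rewrite mulgA.
  by exists (t * x)%g, s; rewrite mulgA; split=> //; exact: Ll.
pose E : set (word0 A) := [set a | s [set b | D (a * b)%g]].
have xE : x E by move: rD; rewrite rxs.
have : x [set u | forall nu : {multiplicative word A n -> word0 A}, F nu ->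
    f [set w | E (u * nu w)%g]].
  apply: filter_finite_forall => // nu Fnu.
  (* Since [x] equals [x * beta_map nu f], membership of [E] in [x] unfolds to the claim for
     [nu]. *)
  by move: xE; rewrite -{1}(fid nu x Fnu Lx).
move=> /(filter_ex (F := x))[u uE].
have fB : f [set w | forall i, row_in M sigma i (B i) w].
  by apply: filter_forall => i; exact: ff.
have fE : f [set w | forall nu : {multiplicative word A n -> word0 A}, F nu ->
    E (u * nu w)%g].
  exact: filter_finite_forall.
have [w [wB wE]] := filter_ex (filterI (F := f) fB fE).
have : s [set b | forall nu : {multiplicative word A n -> word0 A}, F nu ->
    D (u * nu w * b)%g].
  exact: filter_finite_forall.
move=> /(filter_ex (F := s))[b bD].
exists (word_catr (word_catl u w) b); split=> [nu Fnu|i].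
  have nuP := F_pres Fnu.
  by rewrite (nuP b _).2 (nuP u _).1; exact: bD.
have [c Bc wc] := wB i; exists c => //.
by rewrite -/(row_value M sigma i _) row_value_catr row_value_catl.
Qed.

End IdempotentsInP.

Theorem theorem4p5 (A : finType) (A_gt0 : (0 < #|A|)%N)
    (m n : nat) (m_gt0 : (0 < m)%N) (le_mn : (m <= n)%N)
    (M : 'M[rat]_m) (M_lower : is_trig_mx M)
    (M_diag : forall i : 'I_m, 0 < M i i)
    (M_below : forall i j : 'I_m, (j < i)%N -> M i j <= 0)
    (F : set {multiplicative word A n -> word0 A})
    (F_fin : finite_set F) (F_neq0 : F !=set0)
    (F_pres : forall nu, F nu -> word0_preserving nu)
    (sigma : 'I_m -> 'I_n) (sigma_inj : injective sigma) :
  compact (P_set M F sigma) /\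
  subsemigroup (P_set M F sigma) /\
  (forall p : beta_pow m posnat, (p * p)%g = p -> P_set M F sigma p).
Proof.
have Pid (p : beta_pow m posnat) : (p * p)%g = p -> P_set M F sigma p.
  by move=> pp; exact: P_set_idempotent.
split; first exact: P_set_compact.
split=> //; split; last by move=> p q; exact: P_set_mul.
(* Nonemptiness of [P_set]: the constant family at an idempotent [e] of [beta posnat] is
   idempotent. *)
have [||e _ ee] := @ellis posnat setT; first exact: closedT.
  split=> //; pose one : posnat := exist _ 1%N isT.
  by exists (Beta (principal_filter_ultra one)).
by exists (fun=> e); apply: Pid; apply/funext => i; exact: ee.
Qed.
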